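(* The number-of-divisors function $\tau(n)$ (for positive integer arguments $n$) can be represented by the arithmetic term $$\mathrm{HW}(M(n))/(n+4)-(n+1)^2,$$ i.e. $\tau(n)$ equals this expression for every integer $n\ge1$, where $$M(n)=\mathcal C(n^2,2)+\mathcal A(-2nx_1x_2,2)+\mathcal A(x_1^2x_2^2,2),$$ with $\mathcal C$ and $\mathcal A$ formed with the parameters $t=n+1$ and $w=n+4$.
   Context: $\tau(n)$ is the number of positive divisors of $n$. $\mathrm{HW}(N)$ is the Hamming weight of $N$ (number of ones in its binary representation). $G_r(q,s)=\sum_{j=0}^{s}j^rq^j$ with $0^0=1$; for each fixed $r$ this has a closed form. Given parameters $t>1$, $w$ (depending on the arguments) and $k\ge1$: $$\mathcal C(\varepsilon,k)=(2^w-\varepsilon+1)\,\frac{2^{2wt^k}-1}{2^w+1},$$ and for a monomial $\mu=\alpha\, b_1^{\beta_1x_1}\cdots b_k^{\beta_kx_k}x_1^{\gamma_1}\cdots x_k^{\gamma_k}$ in the formal variables $x_1,\dots,x_k$ (with $\alpha$ an integer possibly negative, and absent exponential factors meaning $\beta_i=0$, absent powers meaning $\gamma_i=0$), $$\mathcal A(\mu,k)=-(2^w-1)\,\alpha\prod_{i=1}^kG_{\gamma_i}\!\left(2^{2wt^{i-1}}b_i^{\beta_i},\,t-1\right).$$ An arithmetic term is an expression built from natural-number constants and the variables by the operations $x+y$, $\max(x-y,0)$, $\lfloor x/y\rfloor$, $x^y$ (with $0^0=1$, $\lfloor x/0\rfloor=0$). Products, $\mathrm{HW}$ and $G_r$ (fixed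 $r$) are expressible by arithmetic terms and are used as abbreviations; formulas are written with ordinary subtraction and exact division for readability. *)

(* Defs.v *)
From HB Require Import structures.
From mathcomp Require Import all_boot all_order all_algebra.

Set Implicit Arguments.
Unset Strict Implicit.
Unset Printing Implicit Defensive.

Import Order.TTheory GRing.Theory Num.Theory.
Local Open Scope ring_scope.

(* Arithmetic terms in k variables. In ssrnat, [subn] is truncated, [divn] is  *)
(* the floor of the quotient with x %/ 0 = 0, and 0 ^ 0 = 1.                   *)
Inductive aterm (k : nat) : Type :=
  | ACst of nat
  | AVar of 'I_k
  | AAdd of aterm k & aterm k
  | ASub of aterm k & aterm k
  | ADiv of aterm k & aterm k
  | AExp of aterm k & aterm k.

Fixpoint aeval (k : nat) (v : 'I_k -> nat) (T : aterm k) : nat :=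
  match T with
  | ACst c => c
  | AVar i => v i
  | AAdd T1 T2 => (aeval v T1 + aeval v T2)%N
  | ASub T1 T2 => (aeval v T1 - aeval v T2)%N
  | ADiv T1 T2 => (aeval v T1 %/ aeval v T2)%N
  | AExp T1 T2 => (aeval v T1 ^ aeval v T2)%N
  end.

Definition tau (n : nat) : nat := size (divisors n).

(* The bit of index i of N is odd (N %/ 2 ^ i); bits of index i >= N vanish    *)
(* because N < 2 ^ N.                                                          *)
Definition HW (N : nat) : nat := (\sum_(i < N) odd (N %/ 2 ^ i))%N.

Definition G (r q s : nat) : nat := (\sum_(j < s.+1) j ^ r * q ^ j)%N.

(* The monomial                                                                *)
(*   coef * \prod_i base i ^ (rate i * x_i) * \prod_i x_i ^ deg i              *)
(* in formal variables x_i; an absent exponential factor is rate i = 0.        *)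
(* Index i : 'I_k stands for the variable x_(i+1).                             *)
Record monomial (k : nat) := Monomial {
  coef : int;
  base : 'I_k -> nat;
  rate : 'I_k -> nat;
  deg : 'I_k -> nat
}.

Definition power_monomial (k : nat) (a : int) (d : 'I_k -> nat) : monomial k :=
  Monomial a (fun=> 1%N) (fun=> 0%N) d.

(* Rational-valued, so that the quotient is exact division. *)
Definition calC (t w : nat) (eps : int) (k : nat) : rat :=
  (2 ^+ w - eps%:~R + 1) * ((2 ^+ (2 * w * t ^ k)%N - 1) / (2 ^+ w + 1)).

(* As i counts from 0, the exponent t ^ (i - 1) of 1-based indexing is t ^ i. *)
Definition calA (t w : nat) (k : nat) (mu : monomial k) : int :=
  - (2 ^+ w - 1) * coef mu *
  \prod_(i < k)
    (G (deg mu i) (2 ^ (2 * w * t ^ i) * base mu i ^ rate mu i)%N (t - 1)%N)%:Z.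

Definition divisor_M (n : nat) : rat :=
  let t := (n + 1)%N in
  let w := (n + 4)%N in
  calC t w (n%:Z ^+ 2) 2
  + (calA t w (power_monomial (- 2 * n%:Z) (fun _ : 'I_2 => 1%N)))%:~R
  + (calA t w (power_monomial 1 (fun _ : 'I_2 => 2%N)))%:~R.

(* Main.v *)
Require Import Defs.
From mathcomp Require Import all_boot all_order all_algebra.
From mathcomp Require Import zify ring.

(** Why it is true. Put w = n + 4, t = n + 1 and B = 2 ^ (2 * w). Expanding the
    closed forms into geometric sums turns M(n) into a number written in base B
    whose digit at position x + t * y, for x, y <= n, is
      (2 ^ w - 1) * (2 ^ w + 1 - (n - x * y) ^ 2).
    The choice of w makes (n - x * y) ^ 2 at most 2 ^ w. When x * y = n the digit
    is 2 ^ (2 * w) - 1, of Hamming weight 2 * w; otherwise it is 2 ^ w - 1 times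
    a number between 1 and 2 ^ w, and every such product has weight exactly w
    ([HW_pred_expn_mul]). Weights of base-B digits add up, so
      HW (M n) = w * (t ^ 2 + #{(x, y) | x * y = n}) = w * (t ^ 2 + tau n),
    which is [HW_packed]; [divisor_M_packed] identifies the packed sum with M(n).

    That the whole expression is an arithmetic term is a closure argument on
    [expressible] functions. Products come from squares. A central binomial
    coefficient is a base-q digit of (q + 1) ^ (2 * N). By Legendre's formula the
    Hamming weight of N is the 2-adic valuation of that coefficient, so
    2 ^ HW N is a gcd with a power of 2. The gcd of a and b counts the
    solutions of a linear equation, hence is a coefficient of a product of two
    geometric series ([gcdn_digit]), read off as a digit again. Finally, the
    exponent of a power of 2 is recovered from
      (1 + q) ^ v = 1 + v * q modulo q ^ 2
    ([log2_expn_mod]). *)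

Set Implicit Arguments.
Unset Strict Implicit.
Unset Printing Implicit Defensive.

Import Order.TTheory GRing.Theory Num.Theory.
Local Open Scope nat_scope.

(** * Binary digits and Hamming weight *)

(** Frees the number of bits that are inspected from the number itself. *)
Lemma HW_bits N K : N < 2 ^ K -> HW N = \sum_(i < K) odd (N %/ 2 ^ i).
Proof.
have widen a b : a <= b -> N < 2 ^ a ->
    \sum_(i < b) odd (N %/ 2 ^ i) = \sum_(i < a) odd (N %/ 2 ^ i).
  move=> leab ltN; rewrite -!(big_mkord xpredT (fun i => odd (N %/ 2 ^ i) : nat)).
  rewrite (big_cat_nat (leq0n a) leab) /= [X in _ + X]big_nat.
  rewrite [X in _ + X]big1 ?addn0 // => i /andP[leai _].
  by rewrite divn_small // (leq_trans ltN) ?leq_exp2l.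
move=> ltNK; rewrite -(widen K (maxn K N) (leq_maxl _ _) ltNK).
by rewrite (widen N (maxn K N) (leq_maxr _ _) (@ltn_expl 2 N isT)).
Qed.

Lemma HW_pack k a b : a < 2 ^ k -> HW (a + 2 ^ k * b) = HW a + HW b.
Proof.
move=> lta; have ltb : b < 2 ^ b by rewrite ltn_expl.
rewrite (HW_bits (K := k + b)); last first.
  by rewrite expnD; have := leq_mul (leqnn (2 ^ k)) ltb; lia.
rewrite big_split_ord /= (HW_bits lta); congr (_ + _); apply: eq_bigr => i _.
  have -> : 2 ^ k = 2 ^ i * (2 * 2 ^ (k - i.+1)).
    by rewrite -expnS -expnD; congr (_ ^ _); have := ltn_ord i; lia.
  rewrite -mulnA addnC mulnC divnMDl ?expn_gt0 // -mulnA mulnC.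
  by rewrite mulnC oddD oddM.
rewrite expnD divnMA addnC mulnC divnMDl ?expn_gt0 // (divn_small lta).
by rewrite addn0.
Qed.

Lemma HW_small b : b < 2 -> HW b = b.
Proof. by move=> ltb; rewrite (@HW_bits _ 1) // big_ord1 divn1; case: b ltb => [|[]]. Qed.

(** Subtracting from the all-ones number 2 ^ w - 1 flips each of the w bits. *)
Lemma HW_complement w z : z < 2 ^ w -> HW (2 ^ w - 1 - z) + HW z = w.
Proof.
elim: w z => [|w IHw] z; first by case: z => // _; rewrite /HW big_ord0.
rewrite expnS => ltz; have ltz2 : z %/ 2 < 2 ^ w by rewrite ltn_divLR // mulnC.
have ltr := ltn_pmod z (isT : 0 < 2).
have ez : z = z %% 2 + 2 ^ 1 * (z %/ 2) by have := divn_eq z 2; lia.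
rewrite [in HW z]ez (HW_pack (k := 1)) //.
have -> : 2 * 2 ^ w - 1 - z = (1 - z %% 2) + 2 ^ 1 * (2 ^ w - 1 - z %/ 2).
  by have := divn_eq z 2; lia.
rewrite (HW_pack (k := 1)); last by lia.
by rewrite !(@HW_small (_ %% _)) // HW_small; have := IHw _ ltz2; lia.
Qed.

(** (2 ^ w - 1) * y is y - 1 in the high bits followed by its w-bit complement
    in the low bits, so the two weights compensate each other. *)
Lemma HW_pred_expn_mul w y : 0 < y <= 2 ^ w -> HW ((2 ^ w - 1) * y) = w.
Proof.
move=> /andP[y0 yw].
have -> : (2 ^ w - 1) * y = (2 ^ w - 1 - y.-1) + 2 ^ w * y.-1.
  by rewrite mulnBl; case: y y0 yw => // y _ yw; rewrite mulnS /=; lia.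
by rewrite HW_pack ?HW_complement; lia.
Qed.

Lemma HW_pred_expn w : HW (2 ^ w - 1) = w.
Proof. by have := @HW_complement w 0; rewrite subn0 [HW 0]big_ord0 addn0 expn_gt0 => ->. Qed.

Lemma packed_lt q (d : nat -> nat) s : (forall i, i < s -> d i < q) ->
  \sum_(i < s) d i * q ^ i < q ^ s.
Proof.
elim: s => [|s IHs] dq; first by rewrite big_ord0.
rewrite big_ord_recr /= expnS.
have ltS := IHs (fun i h => dq i (ltnW h)).
apply: leq_trans (leq_mul (dq s (leqnn _)) (leqnn (q ^ s))).
by rewrite mulSn ltn_add2r.
Qed.

Lemma HW_packed_sum m (d : nat -> nat) s : (forall i, i < s -> d i < 2 ^ m) ->
  HW (\sum_(i < s) d i * (2 ^ m) ^ i) = \sum_(i < s) HW (d i).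
Proof.
elim: s => [|s IHs] dq; first by rewrite !big_ord0 [HW 0]big_ord0.
have dq' i (h : i < s) := dq i (ltnW h).
rewrite !big_ord_recr /= -IHs // -(HW_pack (k := m * s)) expnM.
  by rewrite [in RHS]mulnC.
exact: packed_lt.
Qed.

(** The way to read a coefficient of a polynomial, with arithmetic operations
    only, from its value at a point q exceeding all coefficients. *)
Lemma digit_packed_sum q (d : nat -> nat) s k :
  (forall i, i < s -> d i < q) -> k < s ->
  (\sum_(i < s) d i * q ^ i) %/ q ^ k %% q = d k.
Proof.
move=> dq lks.
have q0 : 0 < q by have := dq k lks; case: (q).
have dk i (h : i < k) := dq i (ltn_trans h lks).
have -> : s = k + (s - k).-1.+1 by lia.
rewrite big_split_ord /=.
under [X in _ + X]eq_bigr => i _ do rewrite expnD mulnCA.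
rewrite -big_distrr /= addnC mulnC divnMDl ?expn_gt0 ?q0 //.
rewrite [X in _ + X]divn_small ?packed_lt // addn0 big_ord_recl /= addn0 muln1.
under eq_bigr => i _ do rewrite expnSr mulnA.
by rewrite -big_distrl addnC modnMDl modn_small ?dq.
Qed.

(** Legendre's formula logn 2 N! = N - HW N: sum the identities
    N %/ 2 ^ i = odd (N %/ 2 ^ i) + 2 * (N %/ 2 ^ i.+1) over i. *)
Lemma HW_Legendre N : HW N + logn 2 N`! = N.
Proof.
rewrite logn_fact // big_add1 big_mkord /=.
set S := \sum_(i < N) N %/ 2 ^ i.+1.
have e1 : HW N + S.*2 = \sum_(i < N) N %/ 2 ^ i.
  rewrite -mul2n /HW /S big_distrr -big_split /=; apply: eq_bigr => i _.
  by rewrite expnSr divnMA divn2 mul2n odd_double_half.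
have e2 : \sum_(i < N.+1) N %/ 2 ^ i = N + S.
  by rewrite big_ord_recl divn1.
move: e2; rewrite big_ord_recr /= -e1 (divn_small (@ltn_expl 2 N isT)).
by clearbody S; lia.
Qed.

Lemma HW_logn_bin N : HW N = logn 2 'C(N.*2, N).
Proof.
have /(congr1 (logn 2)) : 'C(N.*2, N) * (N`! * (N.*2 - N)`!) = (N.*2)`!.
  by apply: bin_fact; rewrite -addnn leq_addr.
rewrite -[in N.*2 - N]addnn addnK !lognM ?muln_gt0 ?fact_gt0 //; last first.
  by rewrite bin_gt0 -addnn leq_addr.
have := HW_Legendre N; have := HW_Legendre N.*2.
have -> : HW N.*2 = HW N.
  by have := @HW_pack 1 0 N; rewrite mul2n add0n => ->; rewrite ?[HW 0]big_ord0.
lia.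
Qed.

(** * Binomials, gcds and logarithms as digits *)

Lemma gcdn_pfactor p m n : prime p -> 0 < m -> logn p m <= n ->
  gcdn m (p ^ n) = p ^ logn p m.
Proof.
move=> p_pr m0 le_n; have [c cop {1}->] := pfactor_coprime p_pr m0.
rewrite -(subnK le_n) expnD -muln_gcdl (eqP (coprimeXr _ _)) ?mul1n //.
by rewrite coprime_sym.
Qed.

Lemma bin_leq_expn2 n i : 'C(n, i) <= 2 ^ n.
Proof.
elim: n i => [|n IHn] [|i] //=; rewrite ?bin0 ?expn_gt0 // binS expnS.
by have := IHn i; have := IHn i.+1; lia.
Qed.

Lemma bin_digit n k : k <= n ->
  'C(n, k) = (2 ^ n.+1 + 1) ^ n %/ (2 ^ n.+1) ^ k %% 2 ^ n.+1.
Proof.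
move=> lekn; rewrite addnC expnDn.
under eq_bigr => i _ do rewrite exp1n mul1n.
rewrite (@digit_packed_sum _ (fun i => 'C(n, i))) // => i _.
by have := bin_leq_expn2 n i; rewrite expnS; have := expn_gt0 2 n; lia.
Qed.

(** With q = 2 ^ E - 1, the power (2 ^ v) ^ E is (q + 1) ^ v, which is
    1 + v * q modulo q ^ 2. *)
Lemma log2_expn_mod v E : 1 < E -> v < 2 ^ E - 1 ->
  (2 ^ v) ^ E %% (2 ^ E - 1) ^ 2 %/ (2 ^ E - 1) = v.
Proof.
move=> E1; have : 1 < 2 ^ E - 1.
  by have := @leq_pexp2l 2 2 E isT E1; lia.
rewrite -expnM mulnC expnM; have := expn_gt0 2 E => /=.
set q := 2 ^ E - 1 => qp q1 vq; have -> : 2 ^ E = q + 1 by rewrite /q; lia.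
have [c ->] : exists c, (q + 1) ^ v = c * q ^ 2 + (v * q + 1).
  elim: v {vq} => [|v [c IHv]]; first by exists 0.
  by exists (c * (q + 1) + v); rewrite expnS IHv; ring.
rewrite modnMDl modn_small; last by have := leq_mul vq (leqnn q); lia.
by rewrite divnMDl ?(ltnW q1) // divn_small ?addn0.
Qed.

Lemma sum_eq_mul x m s : 0 < x -> m < x * s ->
  \sum_(y < s) (x * y == m) = (x %| m).
Proof.
move=> x0 ltm; have [/dvdnP[y e]|ndvd] := boolP (x %| m).
  have lty : y < s by rewrite -(ltn_pmul2l x0) mulnC -e.
  rewrite (bigD1 (Ordinal lty)) //= big1 ?addn0 => [|i /negbTE ne].
    by rewrite e mulnC eqxx.
  by rewrite e mulnC eqn_pmul2r // -(inj_eq val_inj) /= in ne *; rewrite ne.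
rewrite big1 // => y _; case: eqP => // e; case/negP: ndvd.
by rewrite -e dvdn_mulr.
Qed.

Lemma tau_count n : 0 < n ->
  tau n = \sum_(x < n.+1) \sum_(y < n.+1) (x * y == n).
Proof.
move=> n0; transitivity (\sum_(x < n.+1) (x %| n)).
  rewrite /tau -(big_mkord xpredT (fun x => (x %| n) : nat)) -big_mkcond.
  rewrite sum1_count -size_filter; apply/perm_size/uniq_perm.
  - exact: divisors_uniq.
  - by rewrite filter_uniq ?iota_uniq.
  move=> x; rewrite mem_filter mem_index_iota -dvdn_divisors //=.
  by case: (boolP (x %| n)) => // /(dvdn_leq n0); rewrite ltnS.
apply: eq_bigr => -[[|x] ltx] _ /=.
  rewrite dvd0n eqn0Ngt n0 big1 // => y _.
  by rewrite mul0n eq_sym eqn0Ngt n0.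
by rewrite sum_eq_mul // mulSn; lia.
Qed.

(** With i' = i + 1 the equation reads b * j = a * (b - i'), which has a solution
    j exactly when b divides a * i', that is, when b %/ gcdn a b divides i'; there
    are gcdn a b such i' between 1 and b. *)
Lemma gcdn_count a b : 0 < a -> 0 < b ->
  \sum_(i < b) \sum_(j < a) (a * i + b * j == a * b.-1) = gcdn a b.
Proof.
move=> a0 b0; have g0 : 0 < gcdn a b by rewrite gcdn_gt0 a0.
have [c eb] := dvdnP (dvdn_gcdr a b).
have c0 : 0 < c by move: b0; rewrite eb muln_gt0 => /andP[].
have dvdE m : (b %| a * m) = (c %| m).
  rewrite -[RHS](dvdn_pmul2r g0) -eb; apply/idP/idP => [ba|bg].
    by rewrite muln_gcdr dvdn_gcd mulnC ba dvdn_mull.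
  by rewrite (dvdn_trans bg) // mulnC dvdn_mul ?dvdn_gcdl.
transitivity (\sum_(i < b) (c %| i.+1)).
  apply: eq_bigr => i _; have ltib := ltn_ord i.
  rewrite -dvdE -(@dvdn_subr b (a * b)) ?dvdn_mull ?leq_pmul2l //.
  rewrite -(@sum_eq_mul b _ a) //; last first.
    by rewrite (mulnC b) -subn_gt0 subKn ?muln_gt0 ?a0 ?leq_pmul2l.
  apply: eq_bigr => j _; congr (nat_of_bool _); apply/eqP/eqP; nia.
(* b %/ c counts the multiples of c between 1 and b *)
transitivity (b %/ c); last by rewrite [X in X %/ _]eb mulKn.
by rewrite divn_count_dvd big_add1 big_mkord.
Qed.

(** The two quotients are the geometric sums of z ^ (a * i) for i < b and of
    z ^ (b * j) for j < a. The coefficient of their product at a * b.-1 is the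
    count of [gcdn_count]; all coefficients are at most a * b < z. *)
Lemma gcdn_digit a b : 0 < a -> 0 < b ->
  let z := 2 ^ (a * b) in
  gcdn a b =
    (z ^ (a * b) - 1) %/ (z ^ a - 1) * ((z ^ (a * b) - 1) %/ (z ^ b - 1))
      %/ z ^ (a * b.-1) %% z.
Proof.
move=> a0 b0 z; have z1 : 1 < z by rewrite -(expn0 2) ltn_exp2l ?muln_gt0 ?a0.
have geom x y : 0 < x -> (z ^ (x * y) - 1) %/ (z ^ x - 1) = \sum_(i < y) z ^ (x * i).
  move=> x0; rewrite expnM !subn1 predn_exp mulKn; last first.
    by rewrite -subn1 subn_gt0 -(expn0 z) ltn_exp2l.
  by apply: eq_bigr => i _; rewrite expnM.
rewrite geom // [a * b in X in _ * X]mulnC geom // big_distrlr /=.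
(* d k is the coefficient of z ^ k in the product *)
pose d k := \sum_(i < b) \sum_(j < a) (a * i + b * j == k).
have -> : \sum_(i < b) \sum_(j < a) z ^ (a * i) * z ^ (b * j) =
    \sum_(k < (a * b).*2) d k * z ^ k.
  under [RHS]eq_bigr => k _ do rewrite /d big_distrl /=.
  rewrite [RHS]exchange_big; apply: eq_bigr => i _.
  under [RHS]eq_bigr => k _ do rewrite big_distrl /=.
  rewrite [RHS]exchange_big; apply: eq_bigr => j _.
  have lt2 : a * i + b * j < (a * b).*2.
    have := ltn_ord i; have := ltn_ord j; nia.
  rewrite (bigD1 (Ordinal lt2)) //= eqxx mul1n -expnD big1 ?addn0 // => k.
  by rewrite -(inj_eq val_inj) eq_sym => /negbTE /= ->.
rewrite (@digit_packed_sum z d) /d ?gcdn_count // => [k _|].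
  apply: (@leq_ltn_trans (\sum_(i < b) \sum_(j < a) 1)); last first.
    by rewrite !sum_nat_const !card_ord muln1 mulnC ltn_expl.
  by apply: leq_sum => i _; apply: leq_sum => j _; case: eqP.
by nia.
Qed.

(** * Closed forms for G *)

Lemma G_recr r q s : G r q s.+1 = G r q s + s.+1 ^ r * q ^ s.+1.
Proof. exact: big_ord_recr. Qed.

(** Multiplying by (q - 1) ^ 2 telescopes the sum; the terms are arranged so that
    the truncated subtraction is exact. *)
Lemma G1E q s : 1 < q ->
  G 1 q s = (s * q ^ s.+2 + q - s.+1 * q ^ s.+1) %/ (q - 1) ^ 2.
Proof.
case: q => // p; rewrite ltnS => p0; rewrite subn1 /=.
have e : G 1 p.+1 s * p ^ 2 + s.+1 * p.+1 ^ s.+1 = s * p.+1 ^ s.+2 + p.+1.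
  elim: s => [|s IHs]; first by rewrite [G _ _ _]big_ord1 !expnS /= !expn0; ring.
  move: IHs; rewrite G_recr !(expnS p.+1 _.+1) expn1.
  by move: (G 1 p.+1 s) (p.+1 ^ s.+1) => g P e; nia.
by rewrite -e addnK mulnK // expn_gt0 p0.
Qed.

Lemma G2E q s : 1 < q ->
  G 2 q s = (s ^ 2 * q ^ s.+3 + s.+1 ^ 2 * q ^ s.+1 + q ^ s.+2
             - (2 * s * s.+1 * q ^ s.+2 + q ^ 2 + q)) %/ (q - 1) ^ 3.
Proof.
case: q => // p; rewrite ltnS => p0; rewrite subn1 /=.
have e : G 2 p.+1 s * p ^ 3 + (2 * s * s.+1 * p.+1 ^ s.+2 + p.+1 ^ 2 + p.+1) =
    s ^ 2 * p.+1 ^ s.+3 + s.+1 ^ 2 * p.+1 ^ s.+1 + p.+1 ^ s.+2.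
  elim: s => [|s IHs]; first by rewrite [G _ _ _]big_ord1 !expnS /= !expn0; ring.
  move: IHs; rewrite G_recr !(expnS p.+1 _.+1).
  by move: (G 2 p.+1 s) (p.+1 ^ s.+1) => g P e; nia.
by rewrite -e addnK mulnK // expn_gt0 p0.
Qed.

(** * Functions given by arithmetic terms *)

Definition expressible k (f : ('I_k -> nat) -> nat) :=
  exists T : aterm k, forall v, aeval v T = f v.

Lemma expressible_ext k (f g : ('I_k -> nat) -> nat) :
  f =1 g -> expressible f -> expressible g.
Proof. by move=> fg [T eT]; exists T => v; rewrite eT. Qed.

Section Closure.
Variables (k : nat).
Implicit Types f g : ('I_k -> nat) -> nat.

Lemma expressible_cst c : @expressible k (fun=> c).
Proof. by exists (ACst k c). Qed.

Lemma expressible_var i : @expressible k (fun v => v i).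
Proof. by exists (AVar i). Qed.

Lemma expressible_add f g : expressible f -> expressible g ->
  expressible (fun v => f v + g v).
Proof. by move=> [S eS] [T eT]; exists (AAdd S T) => v /=; rewrite eS eT. Qed.

Lemma expressible_sub f g : expressible f -> expressible g ->
  expressible (fun v => f v - g v).
Proof. by move=> [S eS] [T eT]; exists (ASub S T) => v /=; rewrite eS eT. Qed.

Lemma expressible_div f g : expressible f -> expressible g ->
  expressible (fun v => f v %/ g v).
Proof. by move=> [S eS] [T eT]; exists (ADiv S T) => v /=; rewrite eS eT. Qed.

Lemma expressible_exp f g : expressible f -> expressible g ->
  expressible (fun v => f v ^ g v).
Proof. by move=> [S eS] [T eT]; exists (AExp S T) => v /=; rewrite eS eT. Qed.

Lemma expressible_succ f : expressible f -> expressible (fun v => (f v).+1).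
Proof. by move=> [S eS]; exists (AAdd S (ACst k 1)) => v /=; rewrite eS addn1. Qed.

Lemma expressible_pred f : expressible f -> expressible (fun v => (f v).-1).
Proof. by move=> [S eS]; exists (ASub S (ACst k 1)) => v /=; rewrite eS subn1. Qed.

Local Hint Resolve expressible_cst expressible_var expressible_add
  expressible_sub expressible_div expressible_exp expressible_succ
  expressible_pred : core.

(** Multiplication is not a primitive operation, but squaring is an instance of
    exponentiation and x * y = ((x + y) ^ 2 - x ^ 2 - y ^ 2) / 2. *)
Lemma expressible_mul f g : expressible f -> expressible g ->
  expressible (fun v => f v * g v).
Proof.
move=> ef eg.
apply: (@expressible_ext _ (fun v => ((f v + g v) ^ 2 - f v ^ 2 - g v ^ 2) %/ 2)).
  by move=> v; rewrite sqrnD -addnA addKn addKn mulKn.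
by auto 10.
Qed.
Local Hint Resolve expressible_mul : core.

Lemma expressible_mod f g : expressible f -> expressible g ->
  expressible (fun v => f v %% g v).
Proof.
move=> ef eg; apply: (@expressible_ext _ (fun v => f v - f v %/ g v * g v)); auto.
by move=> v; rewrite {1}(divn_eq (f v) (g v)) addKn.
Qed.
Local Hint Resolve expressible_mod : core.

Lemma expressible_gcd f g : expressible f -> expressible g ->
  (forall v, 0 < f v) -> (forall v, 0 < g v) ->
  expressible (fun v => gcdn (f v) (g v)).
Proof.
move=> ef eg f0 g0; eapply expressible_ext.
  by move=> v; rewrite gcdn_digit.
by cbv zeta; auto 20.
Qed.

Lemma expressible_bin f g : expressible f -> expressible g ->
  (forall v, g v <= f v) -> expressible (fun v => 'C(f v, g v)).
Proof.
move=> ef eg legf; eapply expressible_ext.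
  by move=> v; rewrite bin_digit.
by auto 20.
Qed.

(** [log2_expn_mod] needs some E with f v < 2 ^ E - 1 that is itself expressible
    from 2 ^ f v; the choice E = (2 ^ f v).+1 is. *)
Lemma expressible_log2 f : expressible (fun v => 2 ^ f v) -> expressible f.
Proof.
set g := fun v => 2 ^ f v => eg.
eapply expressible_ext => [v|].
  rewrite -[RHS](@log2_expn_mod _ (g v).+1) -/(g v) //.
  - by rewrite ltnS expn_gt0.
  have := ltn_expl (f v) (isT : 1 < 2); have := ltn_expl (g v) (isT : 1 < 2).
  by rewrite -/(g v) expnS; lia.
by auto 20.
Qed.

(** The power 2 ^ HW N is the 2-part of 'C(2 * N, N), which is its gcd with 2 ^ N
    because HW N <= N. *)
Lemma expressible_HW f : expressible f -> expressible (fun v => HW (f v)).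
Proof.
move=> ef; apply: expressible_log2.
apply: (@expressible_ext _ (fun v => gcdn 'C(2 * f v, f v) (2 ^ f v))) => [v|].
  rewrite HW_logn_bin mul2n gcdn_pfactor //.
  - by rewrite bin_gt0 -addnn leq_addr.
  by rewrite -HW_logn_bin; have := HW_Legendre (f v); lia.
apply: expressible_gcd => [||v|v]; rewrite ?expn_gt0 ?bin_gt0 ?leq_pmull //; auto.
by apply: expressible_bin => [||v]; rewrite ?leq_pmull //; auto.
Qed.

Lemma expressible_G1 f g : expressible f -> expressible g ->
  (forall v, 1 < f v) -> expressible (fun v => G 1 (f v) (g v)).
Proof.
move=> ef eg f1; eapply expressible_ext => [v|].
  by rewrite G1E.
by auto 20.
Qed.

Lemma expressible_G2 f g : expressible f -> expressible g ->
  (forall v, 1 < f v) -> expressible (fun v => G 2 (f v) (g v)).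
Proof.
move=> ef eg f1; eapply expressible_ext => [v|].
  by rewrite G2E.
by auto 20.
Qed.

End Closure.

(** * The packed sum and its weight *)

(** The digit of M(n) attached to a pair with x * y = p, that is
    (2 ^ w - 1) * (2 ^ w + 1 - (n - p) ^ 2) with w = n + 4, arranged so that each
    truncated subtraction is exact for p <= n ^ 2. *)
Definition cell n p :=
  (2 ^ (n + 4) - 1) * (2 ^ (n + 4) + 1 - n ^ 2 + 2 * n * p - p ^ 2).

Definition packed n :=
  \sum_(y < n.+1) (\sum_(x < n.+1) cell n (x * y) * (2 ^ (2 * (n + 4))) ^ x)
    * (2 ^ (2 * (n + 4) * n.+1)) ^ y.

(** The bound that dictates w = n + 4. From n = 6 on, replacing n by n + 1 at most
    doubles the left-hand side; the smaller cases are checked by computation. *)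
Lemma sqr_subn_bound n : (n ^ 2 - n) ^ 2 <= 2 ^ (n + 4).
Proof.
have [|n6] := ltnP n 6; first by do 6 case: n => [|n] //.
rewrite -(subnK n6); elim: (n - 6) => [//|m].
rewrite !addSn (expnS 2) => IHm; apply: leq_trans (leq_mul (leqnn 2) IHm).
by nia.
Qed.

Lemma sqr_bound n : n ^ 2 <= 2 ^ (n + 4).
Proof.
have [|n2] := ltnP n 2; first by do 2 case: n => [|n] //.
apply: leq_trans (sqr_subn_bound n); nia.
Qed.

(** It says (n - p) ^ 2 <= 2 ^ (n + 4). Since 0 <= p <= n ^ 2, the distance of p to n
    is at most n or at most n ^ 2 - n. *)
Lemma sqr_dist_bound n p : p <= n ^ 2 ->
  n ^ 2 + p ^ 2 <= 2 ^ (n + 4) + 2 * n * p.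
Proof.
move=> lep; have := sqr_bound n; have [le2|lt2] := leqP p (2 * n); first by nia.
move=> _; apply: (@leq_trans ((n ^ 2 - n) ^ 2 + 2 * n * p)).
  (* as 2 * n < p <= n ^ 2, the product p * (p - 2 * n) is largest at p = n ^ 2 *)
  have e : n ^ 2 * (n ^ 2 - 2 * n) + n ^ 2 = (n ^ 2 - n) ^ 2 by nia.
  rewrite -e; have := leq_mul lep (leq_sub2r (2 * n) lep).
  by nia.
by rewrite leq_add2r sqr_subn_bound.
Qed.

Lemma HW_cell n p : p <= n ^ 2 ->
  HW (cell n p) = (n + 4) * (1 + (p == n)).
Proof.
move=> lep; have := sqr_dist_bound lep; have := sqr_bound n.
rewrite /cell; have [->|ne] := eqVneq p n => le1 le2.
  have -> : 2 ^ (n + 4) + 1 - n ^ 2 + 2 * n * n - n ^ 2 = 2 ^ (n + 4) + 1 by nia.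
  by rewrite -[X in _ * (_ + X)](exp1n 2) -subn_sqr exp1n -expnM HW_pred_expn.
rewrite addn0 muln1 HW_pred_expn_mul //; move: (2 ^ (n + 4)) le1 le2 => W le1 le2.
have lt2 : 2 * n * p < n ^ 2 + p ^ 2 by nia.
by apply/andP; split; lia.
Qed.

Lemma cell_lt n p : p <= n ^ 2 -> cell n p < 2 ^ (2 * (n + 4)).
Proof.
move=> lep; have := sqr_dist_bound lep; have := sqr_bound n.
rewrite /cell (mulnC 2 (n + 4)) expnM; have := expn_gt0 2 (n + 4) => /=.
move: (2 ^ (n + 4)) => W W0 le1 le2.
have le3 : 2 * n * p <= n ^ 2 + p ^ 2 by rewrite -mulnA (nat_Cauchy n p).
apply: (@leq_ltn_trans ((W - 1) * (W + 1))); last by nia.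
by rewrite leq_mul2l; apply/orP; right; lia.
Qed.

Lemma HW_packed n : 0 < n -> HW (packed n) = (n + 4) * (n.+1 ^ 2 + tau n).
Proof.
move=> n0.
have le2 x y : x < n.+1 -> y < n.+1 -> x * y <= n ^ 2 by move=> *; exact: leq_mul.
rewrite /packed.
rewrite (@HW_packed_sum _ (fun y =>
    \sum_(x < n.+1) cell n (x * y) * (2 ^ (2 * (n + 4))) ^ x)); last first.
  by move=> y lty; rewrite [X in _ < X]expnM; apply: (@packed_lt _ (fun x => cell n (x * y))) => x ltx; apply/cell_lt/le2.
rewrite tau_count // [in RHS]exchange_big [in RHS]mulnDr [in RHS]big_distrr /=.
transitivity (\sum_(y < n.+1) \sum_(x < n.+1) (n + 4) * (1 + (x * y == n))).
  apply: eq_bigr => y _; rewrite (@HW_packed_sum _ (fun x => cell n (x * y))).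
    by apply: eq_bigr => x _; rewrite HW_cell ?le2.
  by move=> x ltx; apply/cell_lt/le2.
have -> : (n + 4) * n.+1 ^ 2 = \sum_(y < n.+1) \sum_(x < n.+1) (n + 4).
  by rewrite !sum_nat_const !card_ord mulnA mulnC.
rewrite -big_split; apply: eq_bigr => y _.
rewrite big_distrr -big_split; apply: eq_bigr => x _.
by rewrite mulnDr muln1.
Qed.

(** * Identification with M(n) *)

Lemma mul_G r q0 q1 s :
  G r q0 s * G r q1 s
    = \sum_(y < s.+1) (\sum_(x < s.+1) (x * y) ^ r * q0 ^ x) * q1 ^ y.
Proof.
rewrite mulnC /G big_distrlr; apply: eq_bigr => y _ /=.
by rewrite big_distrl; apply: eq_bigr => x _ /=; rewrite expnMn; ring.
Qed.

(** The quotient in C is exact: 2 ^ w + 1 divides 2 ^ (2 * w) - 1 with quotient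
    2 ^ w - 1, and the remaining factor is the geometric sum over the t ^ 2
    positions x + t * y. *)
Lemma repunit w t : 
  2 ^ (2 * w * t ^ 2) - 1 = (2 ^ w + 1) * ((2 ^ w - 1) *
    \sum_(y < t) (\sum_(x < t) (2 ^ (2 * w)) ^ x) * (2 ^ (2 * w * t)) ^ y).
Proof.
rewrite -big_distrr /= mulnA.
have -> : (2 ^ w + 1) * (2 ^ w - 1) = 2 ^ (2 * w) - 1.
  by rewrite (mulnC 2 w) expnM; have := expn_gt0 2 w; nia.
rewrite mulnA [2 ^ (2 * w * t)]expnM [2 ^ (2 * w * t ^ 2)]expnM.
by rewrite !subn1 -predn_exp -predn_exp (expnM _ t t).
Qed.

(** Digit by digit this is the expansion of (n - x * y) ^ 2, with the subtracted
    contribution of x ^ 2 * y ^ 2 moved to the left so that it holds in nat. Both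
    the rational M(n) and a natural-number expression for it are derived from it. *)
Lemma packed_balance n :
  let w := n + 4 in
  packed n + (2 ^ w - 1) * (G 2 (2 ^ (2 * w)) n * G 2 (2 ^ (2 * w * n.+1)) n) =
  (2 ^ w + 1 - n ^ 2) * ((2 ^ (2 * w * n.+1 ^ 2) - 1) %/ (2 ^ w + 1))
  + (2 ^ w - 1) * (2 * n) * (G 1 (2 ^ (2 * w)) n * G 1 (2 ^ (2 * w * n.+1)) n).
Proof.
move=> w; rewrite repunit mulKn ?addn1 // !mul_G.
rewrite mulnA !big_distrr -!big_split; apply: eq_bigr => y _ /=.
rewrite !mulnA -!mulnDl; congr (_ * _).
rewrite !big_distrr -!big_split; apply: eq_bigr => x _ /=.
rewrite !mulnA -!mulnDl; congr (_ * _).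
have lep : x * y <= n ^ 2 by apply: leq_mul; [have := ltn_ord x|have := ltn_ord y].
rewrite /cell -/w; have := sqr_dist_bound lep; have := sqr_bound n; rewrite -/w.
move: (2 ^ w) => W le1 le2.
set c := W + 1 - n ^ 2 + 2 * n * (x * y) - (x * y) ^ 2.
have e : c + (x * y) ^ 2 = W + 1 - n ^ 2 + 2 * n * (x * y) by rewrite /c; lia.
transitivity ((W - 1) * (c + (x * y) ^ 2)); first by ring.
by rewrite e addn1; ring.
Qed.

(** M(n) with the negative part subtracted last, so that truncated subtraction
    agrees with the rational one. *)
Definition nat_M n :=
  let w := n + 4 in
  (2 ^ w + 1 - n ^ 2) * ((2 ^ (2 * w * n.+1 ^ 2) - 1) %/ (2 ^ w + 1))
  + (2 ^ w - 1) * (2 * n) * (G 1 (2 ^ (2 * w)) n * G 1 (2 ^ (2 * w * n.+1)) n)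
  - (2 ^ w - 1) * (G 2 (2 ^ (2 * w)) n * G 2 (2 ^ (2 * w * n.+1)) n).

Lemma expressible_packed : expressible (fun v : 'I_1 -> nat => packed (v ord0)).
Proof.
have en : expressible (fun v : 'I_1 -> nat => v ord0) by apply: expressible_var.
have ew : expressible (fun v : 'I_1 -> nat => v ord0 + 4).
  by apply: expressible_add => //; apply: expressible_cst.
have q0 (n : nat) : 1 < 2 ^ (2 * (n + 4)) by rewrite -(expn0 2) ltn_exp2l; lia.
have q1 (n : nat) : 1 < 2 ^ (2 * (n + 4) * n.+1) by rewrite -(expn0 2) ltn_exp2l; lia.
apply: (@expressible_ext _ (fun v => nat_M (v ord0))) => [v|].
  by rewrite /nat_M -packed_balance addnK.
rewrite /nat_M /=.
repeat first
  [ exact: en | exact: ew | exact: expressible_cst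
  | apply: expressible_G1 | apply: expressible_G2
  | apply: expressible_add | apply: expressible_sub
  | apply: expressible_mul | apply: expressible_div
  | apply: expressible_exp | apply: expressible_succ | done ].
Qed.

Local Open Scope ring_scope.

Lemma divisor_M_packed n : divisor_M n = (packed n)%:R.
Proof.
have := sqr_bound n; have := packed_balance n.
have [R] : exists R, (2 ^ (2 * (n + 4) * n.+1 ^ 2) - 1 = (2 ^ (n + 4) + 1) * R)%N.
  by rewrite repunit; eexists.
have : (0 < 2 ^ (2 * (n + 4) * n.+1 ^ 2))%N by rewrite expn_gt0.
have : (0 < 2 ^ (n + 4))%N by rewrite expn_gt0.
rewrite /divisor_M /calC /calA /= !addnK [(n + 1)%N]addn1.
rewrite !big_ord_recl !big_ord0 /bump /= ?expn0 ?expn1 ?muln1 -!natrX.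
rewrite !mulr1 -!PoszM.
move: (G 1 _ n * _)%N (G 2 _ n * _)%N => g1 g2.
move: (2 ^ (n + 4))%N (2 ^ (2 * (n + 4) * n.+1 ^ 2))%N (packed n) => W Q P.
move=> W0 Q0 eQ eP leW.
have {Q0}eQ : Q = ((W + 1) * R + 1)%N by lia.
have {leW}leW : (n ^ 2 <= W + 1)%N by lia.
subst Q; move: eP => /(congr1 (fun m : nat => m%:R : rat)).
have W10 : (0 < W + 1)%N by rewrite addn1.
rewrite addnK mulKn // !natrD !natrM !natrB // !natrD => eP.
have W1 : W%:R + 1 != 0 :> rat by rewrite natr1 pnatr_eq0.
rewrite -[P%:R](addrK ((W%:R - 1) * g2%:R)) eP natrX.
rewrite !(rmorphXn, rmorphM, rmorphN, rmorphB, rmorph1) /= -!pmulrn.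
by field.
Qed.

Theorem theorem4p3 :
  exists T : aterm 1,
    forall n : nat, (0 < n)%N ->
      exists N : nat,
        [/\ divisor_M n = N%:R,
            (aeval (fun=> n) T)%:R
              = (HW N)%:R / (n + 4)%:R - (n + 1)%:R ^+ 2 :> rat
          & (tau n)%:R = (HW N)%:R / (n + 4)%:R - (n + 1)%:R ^+ 2 :> rat].
Proof.
have [T eT] : expressible (fun v : 'I_1 -> nat =>
    HW (packed (v ord0)) %/ (v ord0 + 4) - (v ord0).+1 ^ 2)%N.
  have en : expressible (fun v : 'I_1 -> nat => v ord0) := expressible_var ord0.
  apply: expressible_sub.
    apply: expressible_div (expressible_add en (expressible_cst 1 4)).
    exact/expressible_HW/expressible_packed.
  exact: expressible_exp (expressible_succ en) (expressible_cst 1 2).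
exists T => n n0; exists (packed n).
have tau_eq : (tau n)%:R
    = (HW (packed n))%:R / (n + 4)%:R - (n + 1)%:R ^+ 2 :> rat.
  rewrite HW_packed // natrM mulrAC mulfV ?mul1r; last first.
    by rewrite pnatr_eq0 addn4.
  by rewrite natrD natrX addn1 addrC addKr.
split=> //; first exact: divisor_M_packed.
by rewrite -tau_eq eT HW_packed // mulKn ?addn4 // addKn.
Qed.
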